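(* Let $\Gamma<\mathrm{SL}_2(\mathbb{R})$ be a subgroup containing $-I$ and commensurable with $\mathrm{SL}_2(\mathbb{Z})$, let $w\in\mathbb{R}$, and let $\psi$ be a multiplier system for $\Gamma$ of weight $w$. Let $h>0$ be the width of $\Gamma$ at infinity, and let $0\le\alpha<1$ be such that $\psi(T^h)=e^{2\pi i\alpha}$. Let $\mu,\nu\in\frac1h(\mathbb{Z}-\alpha)$, and assume that the limits defining the Rademacher series $c_{\Gamma,\psi,w}(\mu,\nu)$ and $c_{\Gamma,\overline{\psi},2-w}(-\nu,-\mu)$ exist. Then $$c_{\Gamma,\overline{\psi},2-w}(-\nu,-\mu)=-\,c_{\Gamma,\psi,w}(\mu,\nu).$$
   Context: Write $\mathrm{e}(x)=e^{2\pi i x}$. All real powers are defined with the principal branch: $x^s=|x|^se^{i\theta s}$ for $x=|x|e^{i\theta}$, $-\pi<\theta\le\pi$; set $0^0=1$, and $0^s=0$ for $s>0$. Group data. Matrices act on the upper half-plane $\mathbb{H}$ by Möbius transformations. For $\gamma\in\mathrm{SL}_2(\mathbb{R})$ with lower row $(c,d)$ put $\mathrm{j}(\gamma,\tau)=(c\tau+d)^{-2}$, and $\mathrm{j}(\gamma,\tau)^{w/2}$ means $(c\tau+d)^{-w}$ (so $\mathrm{j}(-I,\tau)^{w/2}=\mathrm{e}(-w/2)$). Let $T^h=\begin{pmatrix}1&h\\0&1\end{pmatrix}$. $\Gamma_\infty$ is the subgroup of upper-triangular matrices in $\Gamma$. The width $h$ of $\Gamma$ at infinity is the unique $h>0$ with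 $\Gamma_\infty=\langle T^h,-I\rangle$. Multiplier systems. A multiplier system for $\Gamma$ of weight $w$ is a function $\psi:\Gamma\to\mathbb{C}$, here with $|\psi(\gamma)|=1$ for all $\gamma\in\Gamma$, such that $$\psi(\gamma_1)\psi(\gamma_2)\,\mathrm{j}(\gamma_1,\gamma_2\tau)^{w/2}\,\mathrm{j}(\gamma_2,\tau)^{w/2}=\psi(\gamma_1\gamma_2)\,\mathrm{j}(\gamma_1\gamma_2,\tau)^{w/2}$$ for all $\gamma_1,\gamma_2\in\Gamma$, $\tau\in\mathbb{H}$, and satisfying the consistency condition $\psi(-I)=\mathrm{e}(w/2)$. The inverse multiplier system is $\overline{\psi}:\gamma\mapsto\overline{\psi(\gamma)}$, a multiplier system of weight $-w$ and hence also of weight $2-w$. Standing assumption: if $\Gamma$ does not act transitively on $\mathbb{Q}\cup\{i\infty\}$ then $\Gamma$ is contained in a group $\tilde\Gamma<\mathrm{SL}_2(\mathbb{R})$ commensurable with $\mathrm{SL}_2(\mathbb{Z})$ that does, and $\psi=\rho\tilde\psi$ with $\rho:\Gamma\to\mathbb{C}^\times$ a group homomorphism and $\tilde\psi$ a multiplier system for $\tilde\Gamma$. Rademacher series. For $K>0$ let $\Gamma_K^\times=\{\begin{pmatrix}a&b\\c&d\end{pmatrix}\in\Gamma: 0<|c|<K\}$. For a multiplier system $\psi$ of weight $w$ with $\psi(T^h)=\mathrm{e}(\alpha)$, and $\mu,\nu\in\frac1h(\mathbb{Z}-\alpha)$, the Rademacher series is $$c_{\Gamma,\psi,w}(\mu,\nu)=\frac1h\lim_{K\to\infty}\sum_{\gamma\in\Gamma_\infty\backslash\Gamma_K^\times/\Gamma_\infty}K_{\gamma,\psi}(\mu,\nu)\,B_{\gamma,w}(\mu,\nu),$$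 the sum being over a complete irredundant set of double coset representatives $\gamma=\begin{pmatrix}a&b\\c&d\end{pmatrix}$ chosen with $c>0$, where $$K_{\gamma,\psi}(\mu,\nu)=\mathrm{e}\!\left(\mu\tfrac ac\right)\mathrm{e}\!\left(\nu\tfrac dc\right)\psi(\gamma),$$ $$B_{\gamma,w}(\mu,\nu)=\begin{cases}\mathrm{e}\!\left(-\frac w4\right)\displaystyle\sum_{k\ge0}\left(\frac{2\pi}{c}\right)^{2k+w}\frac{(-\mu)^k}{k!}\frac{\nu^{k+w-1}}{\Gamma(k+w)},&w\ge1,\\[2ex]\mathrm{e}\!\left(-\frac w4\right)\displaystyle\sum_{k\ge0}\left(\frac{2\pi}{c}\right)^{2k+2-w}\frac{(-\mu)^{k+1-w}}{\Gamma(k+2-w)}\frac{\nu^k}{k!},&w\le1\end{cases}$$ (here $\Gamma(\cdot)$ with a numerical argument is the Gamma function). The series $c_{\Gamma,\overline\psi,2-w}$ is defined in the same way with $(\psi,w)$ replaced by $(\overline\psi,2-w)$; since $\overline\psi(T^h)=\mathrm{e}(-\alpha)$, its arguments lie in $\frac1h(\mathbb{Z}+\alpha)$. *)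

(* Defs.v *)
From HB Require Import structures.
From mathcomp Require Import all_boot all_order all_algebra.
From mathcomp Require Import all_classical all_reals all_analysis.
From mathcomp Require Import complex.

Set Implicit Arguments.
Unset Strict Implicit.
Unset Printing Implicit Defensive.

Import Order.TTheory GRing.Theory Num.Theory.
Import numFieldNormedType.Exports.

Local Open Scope classical_set_scope.
Local Open Scope ring_scope.
Local Open Scope complex_scope.

(* The topology of R[i] given by its norm, as for any numFieldType. *)
HB.instance Definition _ (R : rcfType) := NormedModule.copy R[i] R[i]^o.

Section ComplexFunctions.
Context {R : realType}.
Implicit Types (z : R[i]) (s x : R).

(* exp (i * theta) *)
Definition expi (theta : R) : R[i] := cos theta +i* sin theta.

(* e(x) = exp (2 * pi * i * x) *)
Definition e1 (x : R) : R[i] := expi (2 * pi * x).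

(* The modulus as an element of R: the library norm `|z| lies in R[i]. *)
Definition cabs z : R := complex.Re `|z|.

(* Principal argument, in ]-pi, pi]; its value at 0 is irrelevant below. *)
Definition carg z : R :=
  xget 0 [set theta : R | - pi < theta <= pi /\ z = (cabs z)%:C * expi theta].

(* Principal branch of z^s. Since 0 `^ 0 = 1 and 0 `^ s = 0 for s != 0, this
   gives 0^0 = 1 and 0^s = 0 for s > 0. *)
Definition cpow z s : R[i] := (cabs z `^ s)%:C * expi (carg z * s).

(* Euler's integral; only used for x >= 1. *)
Definition Gamma (x : R) : R :=
  \int[lebesgue_measure]_(t in `]0, +oo[) (t `^ (x - 1) * expR (- t)).

End ComplexFunctions.

Section GroupData.
Context {R : realType}.
Implicit Types (G H : set 'M[R]_2) (g : 'M[R]_2) (tau : R[i]).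

Definition upper_half_plane : set R[i] := [set tau | 0 < complex.Im tau].

Definition mobius g tau : R[i] :=
  ((g 0 0)%:C * tau + (g 0 1)%:C) / ((g 1 0)%:C * tau + (g 1 1)%:C).

(* j(g, tau)^{w/2} = (c tau + d)^{-w} *)
Definition jpow (w : R) g tau : R[i] :=
  cpow ((g 1 0)%:C * tau + (g 1 1)%:C) (- w).

Definition is_subgroup G : Prop :=
  [/\ G 1, (forall g1 g2, G g1 -> G g2 -> G (g1 * g2)) &
      (forall g, G g -> g \is a GRing.unit /\ G g^-1)].

Definition SL2 : set 'M[R]_2 := [set g | \det g = 1].

Definition SL2Z : set 'M[R]_2 :=
  [set g | \det g = 1 /\ forall i j, g i j \is a Num.int].

(* H is contained in G, with finitely many left cosets g H, g in G. *)
Definition finite_index G H : Prop :=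
  H `<=` G /\ finite_set [set [set g * x | x in H] | g in G].

Definition commensurable G H : Prop :=
  finite_index G (G `&` H) /\ finite_index H (G `&` H).

Definition generated_subgroup (A : set 'M[R]_2) : set 'M[R]_2 :=
  smallest is_subgroup A.

(* The translation matrix (1, h; 0, 1). *)
Definition translation (h : R) : 'M[R]_2 := 1 + h *: delta_mx 0 1.

Definition stab_infty G : set 'M[R]_2 := [set g | G g /\ g 1 0 = 0].

Definition is_width G (h : R) : Prop :=
  0 < h /\ stab_infty G = generated_subgroup [set translation h; -1].

(* The action on the projective real line R u {i oo}, with None for i oo. *)
Definition mobius_line g (x : option R) : option R :=
  match x with
  | Some r => if g 1 0 * r + g 1 1 == 0 then None
              else Some ((g 0 0 * r + g 0 1) / (g 1 0 * r + g 1 1))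
  | None => if g 1 0 == 0 then None else Some (g 0 0 / g 1 0)
  end.

(* Q u {i oo} *)
Definition cusps : set (option R) :=
  None |` [set Some (ratr q) | q in [set: rat]].

Definition transitive_on_cusps G : Prop :=
  forall x y, cusps x -> cusps y -> exists2 g, G g & mobius_line g x = y.

End GroupData.

Section MultiplierSystems.
Context {R : realType}.
Implicit Types (G : set 'M[R]_2) (w : R) (psi : 'M[R]_2 -> R[i]).

(* Functions on G are represented by functions on all matrices, of which only
   the values on G matter. *)
Definition multiplier_system G w psi : Prop :=
  [/\ (forall g, G g -> `|psi g| = 1),
      (forall g1 g2 tau, G g1 -> G g2 -> upper_half_plane tau ->
         psi g1 * psi g2 * jpow w g1 (mobius g2 tau) * jpow w g2 tau
         = psi (g1 * g2) * jpow w (g1 * g2) tau) &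
      psi (-1) = e1 (w / 2)].

Definition conj_multiplier psi : 'M[R]_2 -> R[i] := fun g => (psi g)^*.

(* rho restricts to a group homomorphism from G to the units of R[i]. *)
Definition complex_character G (rho : 'M[R]_2 -> R[i]) : Prop :=
  (forall g, G g -> rho g != 0) /\
  (forall g1 g2, G g1 -> G g2 -> rho (g1 * g2) = rho g1 * rho g2).

(* The weight w' of psi' is not prescribed; w' = w is allowed. *)
Definition extends_to_one_cusp G psi : Prop :=
  exists (G' : set 'M[R]_2) (w' : R) (rho psi' : 'M[R]_2 -> R[i]),
    [/\ [/\ is_subgroup G', G' `<=` SL2, commensurable G' SL2Z & G `<=` G'],
        transitive_on_cusps G',
        complex_character G rho,
        multiplier_system G' w' psi' &
        forall g, G g -> psi g = rho g * psi' g].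

End MultiplierSystems.

Section RademacherSeries.
Context {R : realType}.
Implicit Types (G S : set 'M[R]_2) (g : 'M[R]_2) (psi : 'M[R]_2 -> R[i]).
Implicit Types (w mu nu h alpha K : R).

(* (1/h) (Z - alpha) *)
Definition shifted_lattice h alpha : set R :=
  [set h^-1 * (n%:~R - alpha) | n in [set: int]].

(* Gamma_K^x *)
Definition truncation G K : set 'M[R]_2 := [set g | G g /\ 0 < `|g 1 0| < K].

Definition double_coset (H : set 'M[R]_2) g : set 'M[R]_2 :=
  [set x | exists a b, [/\ H a, H b & x = a * g * b]].

(* S is a complete irredundant set of representatives, all with c > 0, of
   Gamma_oo \ Gamma_K^x / Gamma_oo. *)
Definition double_coset_reps G K S : Prop :=
  [/\ S `<=` truncation G K, (forall g, S g -> 0 < g 1 0) &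
      forall g, truncation G K g ->
        exists! s, S s /\ double_coset (stab_infty G) s g].

Definition kloosterman psi mu nu g : R[i] :=
  e1 (mu * (g 0 0 / g 1 0)) * e1 (nu * (g 1 1 / g 1 0)) * psi g.

Definition bessel_term_ge1 w mu nu (c : R) (k : nat) : R[i] :=
  ((2 * pi / c) `^ ((2 * k)%:R + w))%:C
  * (((- mu) ^+ k)%:C / (k`!%:R)%:C)
  * (cpow nu%:C (k%:R + w - 1) / (Gamma (k%:R + w))%:C).

Definition bessel_term_le1 w mu nu (c : R) (k : nat) : R[i] :=
  ((2 * pi / c) `^ ((2 * k)%:R + 2 - w))%:C
  * (cpow (- mu)%:C (k%:R + 1 - w) / (Gamma (k%:R + 2 - w))%:C)
  * ((nu ^+ k)%:C / (k`!%:R)%:C).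

(* The two expressions agree at w = 1. *)
Definition bessel w mu nu g : R[i] :=
  e1 (- (w / 4)) *
  (if 1 <= w then limn (series (bessel_term_ge1 w mu nu (g 1 0)))
   else limn (series (bessel_term_le1 w mu nu (g 1 0)))).

(* S K is the chosen set of representatives for Gamma_oo \ Gamma_K^x / Gamma_oo,
   a finite set for the groups considered. *)
Definition rademacher_sum (S : R -> set 'M[R]_2) psi w mu nu K : R[i] :=
  \sum_(g \in S K) kloosterman psi mu nu g * bessel w mu nu g.

Definition rademacher_cvg (S : R -> set 'M[R]_2) psi w mu nu : Prop :=
  cvg (rademacher_sum S psi w mu nu K @[K --> +oo]).

Definition rademacher (S : R -> set 'M[R]_2) h psi w mu nu : R[i] :=
  (h^-1)%:C * lim (rademacher_sum S psi w mu nu K @[K --> +oo]).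

End RademacherSeries.

(* Main.v *)
Require Import Defs.
From HB Require Import structures.
From mathcomp Require Import all_boot all_order all_algebra.
From mathcomp Require Import all_classical all_reals all_analysis.
From mathcomp Require Import complex ring lra.

(* The involution g |-> -g^-1, (a, b; c, d) |-> (-d, b; c, -a), permutes the
   double cosets and keeps c fixed. The consistency condition gives
   psi(g) psi(-g^-1) = e(w/2), so the Kloosterman term of g for the data
   (conj psi, 2 - w, -nu, -mu) is e(-w/2) times that of -g^-1 for
   (psi, w, mu, nu). The Bessel series of the two data agree termwise, their
   prefactors e(-(2-w)/4) and e(-w/4) differing by -e(w/2). Hence the truncated
   sums are already opposite for every K; the choice of representatives is
   irrelevant because mu and nu lie in (1/h)(Z - alpha). *)

Set Implicit Arguments.
Unset Strict Implicit.
Unset Printing Implicit Defensive.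

Import Order.TTheory GRing.Theory Num.Theory.
Import numFieldNormedType.Exports.

Local Open Scope classical_set_scope.
Local Open Scope ring_scope.
Local Open Scope complex_scope.

(** * The exponentials [expi] and [e1], and principal powers *)

Section Exponentials.
Context {R : realType}.
Implicit Types (z : R[i]) (x y s theta : R).

Lemma expi0 : expi (0 : R) = 1.
Proof. by rewrite /expi cos0 sin0. Qed.

Lemma expiD x y : expi (x + y) = expi x * expi y.
Proof.
rewrite /expi cosD sinD; apply/eqP.
by rewrite eq_complex /= [sin x * _ + _]addrC !eqxx.
Qed.

Lemma e1D x y : e1 (x + y) = e1 x * e1 y.
Proof. by rewrite /e1 mulrDr expiD. Qed.

Lemma e1_0 : e1 (0 : R) = 1.
Proof. by rewrite /e1 mulr0 expi0. Qed.

Lemma e1_1 : e1 (1 : R) = 1.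
Proof. by rewrite /e1 /expi mulr1 mulr_natl cos2pi sin2pi. Qed.

Lemma e1_half : e1 (2^-1 : R) = -1.
Proof.
rewrite /e1 /expi mulrAC divff ?pnatr_eq0// mul1r cospi sinpi.
by apply/eqP; rewrite eq_complex /= oppr0 !eqxx.
Qed.

Lemma e1_int (n : int) : e1 (n%:~R : R) = 1.
Proof.
have en (k : nat) : e1 (k%:R : R) = 1.
  by elim: k => [|k IH]; rewrite ?e1_0// -natr1 e1D IH e1_1 mulr1.
case: n => k; first exact: en.
rewrite NegzE mulrNz; have := e1D (- k.+1%:R) k.+1%:R.
by rewrite addNr e1_0 en mulr1 => ->.
Qed.

Lemma e1_neq0 x : e1 x != 0.
Proof.
apply/eqP => x0; have := e1D x (- x).
by rewrite subrr e1_0 x0 mul0r => /eqP; rewrite oner_eq0.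
Qed.

(** Equal cosines give [|x| = |y|], cosine being injective on [0, pi]; equal sines then settle the
    sign. *)
Lemma expi_inj : {in `]-pi, pi] &, injective (@expi R)}.
Proof.
move=> x y; rewrite !in_itv/= => /andP[x1 x2] /andP[y1 y2] [cxy sxy].
have pi0 := @pi_gt0 R.
have cosabs t : cos `|t| = cos t :> R.
  by case: (ger0P t) => // _; rewrite cosN.
have absxy : `|x| = `|y|.
  by apply: cos_inj; rewrite ?cosabs// in_itv/= normr_ge0 ler_norml/= ltW.
have /eqP := absxy; rewrite eqr_norm2 => /orP[/eqP//|/eqP xy].
move: sxy; rewrite xy sinN => /eqP; rewrite eq_sym -subr_eq0 opprK -mulr2n.
rewrite mulrn_eq0/= => /eqP sy0.
(* Here x = -y, so x > -pi excludes y = pi, the only nonzero zero of the sine in the interval. *)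
have [y0|y0|->] := ltgtP y 0; last by rewrite oppr0.
- have : 0 < sin (- y) by apply: sin_gt0_pi; apply/andP; split; lra.
  by rewrite sinN sy0 oppr0 ltxx.
- have : 0 < sin y by apply: sin_gt0_pi; apply/andP; split; lra.
  by rewrite sy0 ltxx.
Qed.

Lemma cabs_expi x : cabs (expi x) = 1.
Proof. by rewrite /cabs normc_def /= cos2Dsin2 sqrtr1. Qed.

Lemma cabs_eq0 z : (cabs z == 0) = (z == 0).
Proof.
rewrite /cabs normc_def /= -(inj_eq (@complexI R)).
by rewrite -[X in X == _]normc_def normr_eq0.
Qed.

Lemma cpow0 s : s != 0 -> cpow (0 : R[i]) s = 0.
Proof.
move=> s0; have -> : cpow (0 : R[i]) s = (0 `^ s)%:C * expi (carg 0 * s).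
  by rewrite /cpow; congr ((_ `^ _)%:C * _); apply/eqP; rewrite cabs_eq0.
by rewrite powR0// mul0r.
Qed.

Lemma cpow00 : cpow (0 : R[i]) 0 = 1.
Proof. by rewrite /cpow powRr0 mulr0 expi0 mulr1. Qed.

(** By [expi_inj] the argument is unique, so the choice in [carg] must return [theta]. The values of
    [cpow] at nonzero bases below all come from here. *)
Lemma cpow_polar r theta s : 0 < r -> - pi < theta <= pi ->
  cpow (r%:C * expi theta) s = (r `^ s)%:C * expi (theta * s).
Proof.
move=> r0 th; have cr : cabs (r%:C * expi theta) = r.
  have -> : cabs (r%:C * expi theta) = cabs r%:C * cabs (expi theta).
    by rewrite /cabs normrM !normc_def /= mulr0 subr0.
  rewrite cabs_expi mulr1 /cabs normc_def /= expr0n addr0 sqrtr_sqr.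
  exact: gtr0_norm.
rewrite /cpow cr; congr (_ * expi (_ * _)).
rewrite /carg; apply: xget_unique; first by rewrite cr.
move=> y [yr]; rewrite cr => /mulfI e.
apply/esym/expi_inj; rewrite ?in_itv//; apply: e.
by rewrite eq_complex /= negb_and gt_eqF.
Qed.


Lemma cpow1 s : cpow (1 : R[i]) s = 1.
Proof.
have := @cpow_polar 1 0 s ltr01; rewrite expi0 mulr1 mul0r powR1 expi0 mulr1.
by apply; rewrite oppr_lt0 pi_gt0 pi_ge0.
Qed.

Lemma cpow_i s : cpow ('i : R[i]) s = e1 (s / 4).
Proof.
have pi0 := @pi_gt0 R.
have := @cpow_polar 1 (pi / 2) s ltr01; rewrite mul1r powR1 mul1r.
have -> : expi (pi / 2) = 'i :> R[i] by rewrite /expi cos_pihalf sin_pihalf.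
move=> -> ; last by apply/andP; split; lra.
by rewrite /e1; congr expi; field.
Qed.

Lemma cpowN1 s : cpow (-1 : R[i]) s = e1 (s / 2).
Proof.
have pi0 := @pi_gt0 R.
have := @cpow_polar 1 pi s ltr01; rewrite mul1r powR1 mul1r.
have -> : expi pi = -1 :> R[i].
  by rewrite /expi cospi sinpi; apply/eqP; rewrite eq_complex /= oppr0 !eqxx.
move=> -> ; last by apply/andP; split; lra.
by rewrite /e1; congr expi; field.
Qed.

Lemma expiMn x (k : nat) : expi (x * k%:R) = expi x ^+ k.
Proof.
elim: k => [|k IH]; first by rewrite mulr0 expi0.
by rewrite -natr1 mulrDr mulr1 expiD IH exprSr.
Qed.

(** A negative base has argument pi, and [expi pi ^+ k] is the sign (-1)^k. This serves weight 1,
    where the exponent k + w - 1 is k. *)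
Lemma cpow_real_nat x (k : nat) : cpow x%:C k%:R = (x ^+ k)%:C.
Proof.
have pi0 := @pi_gt0 R.
have rX (r : R) : (r ^+ k)%:C = r%:C ^+ k by rewrite rmorphXn.
have [x0|x0|->] := ltgtP x 0; last first.
- case: k rX => [|k] _; first exact: cpow00.
  by rewrite cpow0 ?pnatr_eq0// expr0n.
- have := @cpow_polar x 0 k%:R x0; rewrite expi0 mulr1 mul0r expi0 mulr1.
  by rewrite powR_mulrn ?ltW//; apply; apply/andP; split; lra.
- have nx0 : 0 < - x by rewrite oppr_gt0.
  have pi_range : (- pi < pi :> R) && (pi <= pi :> R).
    by rewrite lexx andbT; lra.
  have := @cpow_polar (- x) pi k%:R nx0 pi_range.
  rewrite expiMn powR_mulrn ?ltW//.
  have -> : expi pi = -1 :> R[i].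
    by rewrite /expi cospi sinpi; apply/eqP; rewrite eq_complex /= oppr0 !eqxx.
  by rewrite rX -exprMn mulrN1 -rmorphN opprK rX.
Qed.

Lemma cpow_neq0 z s : z != 0 -> cpow z s != 0.
Proof.
move=> z0; rewrite /cpow mulf_neq0//.
  rewrite -[0]/(0%:C) (inj_eq (@complexI R)) gt_eqF// powR_gt0//.
  by rewrite lt_neqAle eq_sym cabs_eq0 z0 /cabs normc_def /= sqrtr_ge0.
(* The phase is a value of [e1], after division of the angle by 2 pi. *)
have := e1_neq0 (carg z * s / (2 * pi)).
by rewrite /e1 mulrC divfK// mulf_neq0 ?gt_eqF ?pi_gt0.
Qed.

End Exponentials.

(** * Duality of the Bessel series under (w, mu, nu) -> (2 - w, -nu, -mu) *)

Section Bessel.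
Context {R : realType}.
Implicit Types (w mu nu : R) (g : 'M[R]_2).

(** The substitution swaps -mu and nu, hence also which of them carries the real exponent. *)
Lemma bessel_term_le1_dual w mu nu c :
  bessel_term_le1 (2 - w) (- nu) (- mu) c = bessel_term_ge1 w mu nu c.
Proof.
apply/funext => k; rewrite /bessel_term_le1 /bessel_term_ge1 opprK.
have -> : (2 * k)%:R + 2 - (2 - w) = (2 * k)%:R + w by ring.
have -> : k%:R + 1 - (2 - w) = k%:R + w - 1 by ring.
have -> : k%:R + 2 - (2 - w) = k%:R + w by ring.
by rewrite mulrAC.
Qed.

(** The substitution is an involution. *)
Lemma bessel_term_ge1_dual w mu nu c :
  bessel_term_ge1 (2 - w) (- nu) (- mu) c = bessel_term_le1 w mu nu c.
Proof.
by rewrite -bessel_term_le1_dual !opprK; congr (bessel_term_le1 _ _ _ _); ring.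
Qed.

(** Weight 1 is its own dual, so [bessel] takes the same branch on both sides. Both powers are
    integral there and trade places over the common denominators k! and Gamma(k + 1). *)
Lemma bessel_term_w1_dual mu nu c :
  bessel_term_ge1 1 (- nu) (- mu) c = bessel_term_ge1 1 mu nu c.
Proof.
apply/funext => k; rewrite /bessel_term_ge1 opprK addrK !cpow_real_nat.
rewrite -!mulrA; congr (_ * _).
by rewrite mulrCA [RHS]mulrCA [in LHS](mulrCA _ _ _^-1).
Qed.

Lemma bessel_dual w mu nu g g' : g' 1 0 = g 1 0 ->
  bessel (2 - w) (- nu) (- mu) g' = - e1 (w / 2) * bessel w mu nu g.
Proof.
move=> cE; rewrite /bessel cE mulrA; congr (_ * _).
  rewrite mulNr -mulN1r -e1_half -!e1D.
  (* The summand 1/2 is the sign -1 = e(1/2); the integer -1 is a full period. *)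
  have -> : - ((2 - w) / 4) = 2^-1 + (w / 2 + - (w / 4)) + (-1)%:~R by field.
  by rewrite [LHS]e1D e1_int mulr1.
have [w1|w1|<-] := ltgtP 1 w.
- rewrite ifF ?bessel_term_le1_dual//; apply/negbTE; rewrite -ltNge; lra.
- rewrite ifT ?bessel_term_ge1_dual//; lra.
- have -> : 2 - 1 = 1 :> R by ring.
  by rewrite lexx bessel_term_w1_dual.
Qed.

End Bessel.

(** * Two-by-two matrices, translations and the stabiliser of infinity *)

Section Matrices.
Context {R : realType}.
Implicit Types (x y : R) (g : 'M[R]_2).

Lemma ord2P (P : 'I_2 -> Prop) : P 0 -> P 1 -> forall i, P i.
Proof.
move=> P0 P1; case=> [[|[|//]] i2].
- by have -> : Ordinal i2 = 0 by apply: val_inj.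
- by have -> : Ordinal i2 = 1 by apply: val_inj.
Qed.

Lemma mulmx2E g1 g2 i j : (g1 * g2) i j = g1 i 0 * g2 0 j + g1 i 1 * g2 1 j.
Proof.
rewrite mxE !big_ord_recl big_ord0 addr0.
by have -> : lift ord0 ord0 = 1 :> 'I_2 by apply: val_inj.
Qed.

Lemma lift2_0 : lift (0 : 'I_2) ord0 = 1.
Proof. exact: val_inj. Qed.

Lemma lift2_1 : lift (1 : 'I_2) ord0 = 0.
Proof. exact: val_inj. Qed.

Lemma det_mx2 g : \det g = g 0 0 * g 1 1 - g 0 1 * g 1 0.
Proof.
rewrite (expand_det_row _ 0) !big_ord_recl big_ord0 addr0 /cofactor !det_mx11.
by rewrite !mxE !lift2_0 lift2_1/= expr0 mul1r expr1 mulN1r mulrN.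
Qed.

Lemma SL2_oppV g : SL2 g ->
  [/\ (- g^-1) 0 0 = - g 1 1, (- g^-1) 0 1 = g 0 1,
      (- g^-1) 1 0 = g 1 0 & (- g^-1) 1 1 = - g 0 0].
Proof.
rewrite /SL2/= => g1; have gU : g \is a GRing.unit.
  by rewrite -[_ \is a _]/(g \in unitmx) unitmxE g1 unitr1.
(* The adjugate of g, which is its inverse because the determinant is 1. *)
pose A : 'M[R]_2 := \matrix_(i, j)
  if i == 0 then if j == 0 then g 1 1 else - g 0 1
  else if j == 0 then - g 1 0 else g 0 0.
have -> : g^-1 = A.
  apply: (mulrI gU); rewrite divrr//; move: g1; rewrite det_mx2 => g1.
  apply/esym/matrixP; apply: ord2P; apply: ord2P; rewrite mulmx2E !mxE/=.
  - by rewrite -g1; ring.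
  - by ring.
  - by ring.
  - by rewrite -g1; ring.
by split; rewrite !mxE/= ?opprK.
Qed.

Lemma translationE x : [/\ translation x 0 0 = 1, translation x 0 1 = x,
  translation x 1 0 = 0 & translation x 1 1 = 1].
Proof. by split; rewrite !mxE /= ?mulr0 ?mulr1 ?addr0 ?add0r. Qed.

Lemma translationD x y : translation (x + y) = translation x * translation y.
Proof.
rewrite /translation mulrDl mul1r mulrDr mulr1 -scalerAl -scalerAr.
rewrite -[delta_mx 0 1 * _]/(delta_mx 0 1 *m _) mul_delta_mx_0// !scaler0 addr0.
by rewrite scalerDl [_ *: _ + _]addrC addrA.
Qed.

Lemma translation0 : translation 0 = 1 :> 'M[R]_2.
Proof. by rewrite /translation scale0r addr0. Qed.

Lemma translation_unit x : translation x \is a GRing.unit.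
Proof.
apply/unitrP; exists (translation (- x)).
by rewrite -!translationD addNr addrN translation0.
Qed.

Lemma translationV x : (translation x)^-1 = translation (- x).
Proof.
by apply: (mulrI (translation_unit x)); rewrite divrr ?translation_unit//
  -translationD subrr translation0.
Qed.

(** Signs are central, so the signed translations by multiples of h form a subgroup; it contains
    both generators, hence the group they generate. *)
Lemma stab_infty_width G (h : R) g : is_width G h -> stab_infty G g ->
  exists (n : int) (e : bool), g = (-1) ^+ e * translation (n%:~R * h).
Proof.
case=> _ -> gG; pose H := [set g | exists (n : int) (e : bool),
  g = (-1) ^+ e * translation (n%:~R * h) :> 'M[R]_2].
suff HG : generated_subgroup [set translation h; -1] `<=` H by exact: HG.
apply: smallest_sub; last first.
  move=> _ [|] ->.
  - by exists 1, false; rewrite mul1r mul1r.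
  - by exists 0, true; rewrite mul0r translation0 mulr1.
split.
- by exists 0, false; rewrite mul0r translation0 mulr1.
- move=> _ _ [n [e ->]] [m [f ->]]; exists (n + m), (e (+) f).
  rewrite intrD mulrDl translationD signr_addb -!mulrA; congr (_ * _).
  by rewrite !mulrA; congr (_ * _); apply/commr_sign.
- move=> _ [n [e ->]]; split.
    by rewrite unitrMl ?translation_unit// unitrX// unitrN1.
  exists (- n), e; rewrite invrM ?translation_unit ?unitrX ?unitrN1//.
  rewrite invr_sign translationV -mulNr -intrN; exact: commr_sign.
Qed.

(** Common induction for left and right translations: invariance under one step on the stable domain
    [P] extends to all integer multiples. *)
Lemma int_translation_invariant (X Y : Type) (P : set X) (act : R -> X -> X)
    (f : X -> Y) (h : R) :
  (forall u, act 0 u = u) -> (forall x y u, act (x + y) u = act x (act y u)) ->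
  (forall (n : int) u, P u -> P (act (n%:~R * h) u)) ->
  (forall u, P u -> f (act h u) = f u) ->
  forall (n : int) u, P u -> f (act (n%:~R * h) u) = f u.
Proof.
move=> act0 actD actP fh.
have en (k : nat) u : P u -> f (act (k%:R * h) u) = f u.
  elim: k => [|k IH] Pu; first by rewrite mul0r act0.
  by rewrite -nat1r mulrDl mul1r actD fh ?IH//; exact: (actP k).
case=> k u Pu; first exact: en.
(* A negative step is undone by a positive one starting from the translated point, which lies in
   [P]. *)
rewrite -[u in RHS]act0 -(subrr (k.+1%:R * h)) actD -mulNr.
by rewrite NegzE mulrNz en//; have := actP (Negz k) u Pu; rewrite NegzE mulrNz.
Qed.

End Matrices.

(** * Multiplier systems and invariance of the Kloosterman terms *)

Section Multipliers.
Context {R : realType}.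
Variables (G : set 'M[R]_2) (w : R) (psi : 'M[R]_2 -> R[i]).
Hypotheses (G_subgroup : is_subgroup G) (G_SL2 : G `<=` SL2).
Hypothesis (psi_mult : multiplier_system G w psi).
Implicit Types (x h mu nu : R) (g : 'M[R]_2).

Lemma psi_normK g : G g -> psi g * (psi g)^* = 1.
Proof.
by case: psi_mult => nrm _ _ gG; rewrite -sqr_normc nrm// expr1n.
Qed.

Lemma jpow_translation x z : jpow w (translation x) z = 1.
Proof.
by rewrite /jpow; have [_ _ -> ->] := translationE x; rewrite mul0r add0r cpow1.
Qed.

Lemma Im_i_gt0 : upper_half_plane ('i : R[i]).
Proof. by rewrite /upper_half_plane/= ltr01. Qed.

Lemma jpow_neq0 g : 0 < g 1 0 -> jpow w g 'i != 0.
Proof.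
move=> c0; apply: cpow_neq0; rewrite eq_complex /= negb_and; apply/orP; right.
by rewrite mulr1 mulr0 !addr0 gt_eqF.
Qed.

(** In the cocycle relation at tau = i, the translation has factor 1 and preserves the lower row of
    g, so the nonzero factor of g cancels. *)
Lemma psi_translationl x g : G (translation x) -> G g -> 0 < g 1 0 ->
  psi (translation x * g) = psi (translation x) * psi g.
Proof.
case: psi_mult => _ cocycle _ xG gG c0.
have := cocycle _ _ _ xG gG Im_i_gt0; rewrite jpow_translation mulr1.
have -> : jpow w (translation x * g) 'i = jpow w g 'i.
  rewrite /jpow !mulmx2E; have [_ _ -> ->] := translationE x.
  by rewrite !mul0r !mul1r !add0r.
by move/(mulIf (jpow_neq0 c0)).
Qed.

Lemma psi_translationr x g : G (translation x) -> G g -> 0 < g 1 0 ->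
  psi (g * translation x) = psi g * psi (translation x).
Proof.
case: psi_mult => _ cocycle _ xG gG c0.
have := cocycle _ _ _ gG xG Im_i_gt0; rewrite jpow_translation mulr1.
(* Both bases are c(i + x) + d, with imaginary part c > 0. *)
have -> : jpow w (g * translation x) 'i = jpow w g (mobius (translation x) 'i).
  rewrite /jpow /mobius !mulmx2E; have [-> -> -> ->] := translationE x.
  congr cpow; rewrite !mulr0 !mulr1 !mul0r add0r mul1r divr1 addr0.
  by rewrite rmorphD rmorphM /=; ring.
have nz : jpow w g (mobius (translation x) 'i) != 0.
  rewrite /mobius; have [-> -> -> ->] := translationE x.
  rewrite mul0r add0r mul1r divr1 /jpow.
  apply: cpow_neq0; rewrite eq_complex /= negb_and; apply/orP; right.
  by rewrite !addr0 !mul0r mulr1 addr0 gt_eqF.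
by move/(mulIf nz).
Qed.

(* Evaluated at tau = (a + i)/c, both automorphy factors have base i. *)
Lemma psi_oppV g : G g -> G (- g^-1) -> 0 < g 1 0 ->
  psi g * psi (- g^-1) = e1 (w / 2).
Proof.
case: psi_mult => _ cocycle psiN1 gG g'G c0.
have cz : (g 1 0)%:C != 0 by rewrite eq_complex /= negb_and gt_eqF.
pose tau : R[i] := ((g 0 0)%:C + 'i) * (g 1 0)^-1%:C.
have gdet := G_SL2 gG.
have [aE bE cE dE] := SL2_oppV gdet.
(* The lower row of [- g^-1] is (c, -a). *)
have tauE : (g 1 0)%:C * tau + (- g 0 0)%:C = 'i.
  by rewrite /tau fmorphV mulrC divfK// rmorphN addrC addrA addNr add0r.
have tau0 : upper_half_plane tau.
  rewrite /upper_half_plane/tau/=.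
  by rewrite mulr0 !add0r mul1r invr_gt0.
(* Multiplied by the denominator i, this reads bc - ad = i^2. *)
have mobE : (g 1 0)%:C * mobius (- g^-1) tau + (g 1 1)%:C = 'i.
  rewrite /mobius aE bE cE dE tauE.
  have i0 : 'i != 0 :> R[i] by rewrite eq_complex /= oner_eq0 andbF.
  apply: (mulIf i0); rewrite mulrDl mulrA divfK//.
  have ii : 'i * 'i = -1 :> R[i] by rewrite -expr2 sqr_i.
  have det1 : (g 0 0)%:C * (g 1 1)%:C - (g 0 1)%:C * (g 1 0)%:C = 1.
    by rewrite -!rmorphM -rmorphB -det_mx2 gdet.
  rewrite ii -det1 /tau fmorphV rmorphN /=.
  by rewrite complexiE; field.
have := cocycle _ _ _ gG g'G tau0.
rewrite /jpow mobE cE dE tauE.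
have gU : g \is a GRing.unit.
  by case: G_subgroup => _ _ /(_ _ gG)[].
(* The product matrix is -I, with factor (-1)^(-w) = e(-w/2); the two factors i^(-w) = e(-w/4)
   multiply to the same value, leaving psi(-I). *)
rewrite mulrN divrr// psiN1 !mxE/= oppr0 mul0r add0r rmorphN cpowN1 !cpow_i.
rewrite -mulrA -!e1D.
have -> : - w / 4 + - w / 4 = - w / 2 by field.
by rewrite [in X in _ = X]e1D => /(mulIf (e1_neq0 _)).
Qed.

Variables (h alpha mu nu : R).
Hypotheses (h_width : is_width G h) (alphaE : psi (translation h) = e1 alpha).
Hypothesis (mu_lattice : shifted_lattice h alpha mu).
Hypothesis (nu_lattice : shifted_lattice h alpha nu).

Lemma stab_infty_translation : stab_infty G (translation h).
Proof. by case: h_width => _ ->; apply: sub_gen_smallest; left. Qed.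

Lemma translation_in : G (translation h).
Proof. by have [] := stab_infty_translation. Qed.

Lemma e1_lattice lam : shifted_lattice h alpha lam ->
  e1 (lam * h) * e1 alpha = 1.
Proof.
case=> n _ <-; rewrite -e1D mulrAC mulVf ?mul1r ?subrK ?e1_int//.
by case: h_width => h0 _; rewrite gt_eqF.
Qed.

Lemma translation_mulE x g :
  [/\ (translation x * g) 0 0 = g 0 0 + x * g 1 0,
      (translation x * g) 1 0 = g 1 0 & (translation x * g) 1 1 = g 1 1].
Proof.
have [t00 t01 t10 t11] := translationE x.
by rewrite !mulmx2E t00 t01 t10 t11 !mul1r !mul0r !add0r.
Qed.

Lemma mul_translationE x g :
  [/\ (g * translation x) 0 0 = g 0 0,
      (g * translation x) 1 0 = g 1 0 &
      (g * translation x) 1 1 = g 1 1 + x * g 1 0].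
Proof.
have [t00 t01 t10 t11] := translationE x.
rewrite !mulmx2E t00 t01 t10 t11 !mulr1 !mulr0 !addr0; split=> //.
by rewrite addrC mulrC.
Qed.

(** The translation adds h to a/c, and the new phase e(mu h) cancels psi(T^h) = e(alpha). On the
    right, d/c and nu play these roles. *)
Lemma kloosterman_translationl g : G g -> 0 < g 1 0 ->
  kloosterman psi mu nu (translation h * g) = kloosterman psi mu nu g.
Proof.
move=> gG c0; rewrite /kloosterman psi_translationl//;
  last exact: translation_in.
have [-> -> ->] := translation_mulE h g.
rewrite alphaE mulrDl mulfK ?gt_eqF// mulrDr e1D.
rewrite -[RHS]mulr1 -(e1_lattice mu_lattice); ring.
Qed.

Lemma kloosterman_translationr g : G g -> 0 < g 1 0 ->
  kloosterman psi mu nu (g * translation h) = kloosterman psi mu nu g.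
Proof.
move=> gG c0; rewrite /kloosterman psi_translationr//;
  last exact: translation_in.
have [-> -> ->] := mul_translationE h g.
rewrite alphaE mulrDl mulfK ?gt_eqF// mulrDr e1D.
rewrite -[RHS]mulr1 -(e1_lattice nu_lattice); ring.
Qed.

Lemma translation_int_in (n : int) : G (translation (n%:~R * h)).
Proof.
case: G_subgroup => G1 GM GV.
have en (k : nat) : G (translation (k%:R * h)).
  elim: k => [|k IH]; first by rewrite mul0r translation0.
  by rewrite -natr1 mulrDl mul1r translationD; exact: GM IH translation_in.
case: n => k; first exact: en.
by rewrite NegzE mulrNz mulNr -translationV; case: (GV _ (en k.+1)).
Qed.

Lemma kloosterman_translationl_int (n : int) g : G g -> 0 < g 1 0 ->
  kloosterman psi mu nu (translation (n%:~R * h) * g) = kloosterman psi mu nu g.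
Proof.
move=> gG c0; pose P g := G g /\ 0 < g 1 0.
apply: (@int_translation_invariant R _ _ P
          (fun x g => translation x * g)) => //.
- by move=> g'; rewrite translation0 mul1r.
- by move=> x y g'; rewrite translationD mulrA.
- move=> m g' [g'G c'0]; split.
    by case: G_subgroup => _ GM _; exact: GM (translation_int_in m) g'G.
  by have [_ -> _] := translation_mulE (m%:~R * h) g'.
- by move=> g' []; exact: kloosterman_translationl.
Qed.

Lemma kloosterman_translationr_int (n : int) g : G g -> 0 < g 1 0 ->
  kloosterman psi mu nu (g * translation (n%:~R * h)) = kloosterman psi mu nu g.
Proof.
move=> gG c0; pose P g := G g /\ 0 < g 1 0.
apply: (@int_translation_invariant R _ _ P
          (fun x g => g * translation x)) => //.
- by move=> g'; rewrite translation0 mulr1.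
(* Right multiplication composes in reverse order; translations commute. *)
- by move=> x y g'; rewrite addrC translationD mulrA.
- move=> m g' [g'G c'0]; split.
    by case: G_subgroup => _ GM _; exact: GM g'G (translation_int_in m).
  by have [_ -> _] := mul_translationE (m%:~R * h) g'.
- by move=> g' []; exact: kloosterman_translationr.
Qed.

(** Up to sign, g is s translated on both sides by multiples of h; positivity of both lower-left
    entries fixes the sign. *)
Lemma double_coset_kloosterman s g : G s -> 0 < s 1 0 -> 0 < g 1 0 ->
  double_coset (stab_infty G) s g ->
  g 1 0 = s 1 0 /\ kloosterman psi mu nu g = kloosterman psi mu nu s.
Proof.
move=> sG s0 g0 [a [b [aG bG gE]]].
have [n [e aE]] := stab_infty_width h_width aG.
have [m [f bE]] := stab_infty_width h_width bG.
pose k := translation (n%:~R * h) * s * translation (m%:~R * h).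
have kG : G (translation (n%:~R * h) * s).
  by case: G_subgroup => _ GM _; exact: GM (translation_int_in n) sG.
have c1 : (translation (n%:~R * h) * s) 1 0 = s 1 0.
  by have [] := translation_mulE (n%:~R * h) s.
have c2 : k 1 0 = s 1 0.
  rewrite -c1.
  by have [] := mul_translationE (m%:~R * h) (translation (n%:~R * h) * s).
have gk : g = (-1) ^+ (e (+) f) * k.
  rewrite gE aE bE signr_addb /k -!mulrA; congr (_ * _); rewrite !mulrA.
  by congr (_ * _); rewrite [LHS]commr_sign mulrA.
have gk' : g = k.
  move: g0; rewrite gk; case: (e (+) f); last by rewrite mul1r.
  by rewrite mulN1r mxE c2 oppr_gt0 ltNge ltW.
rewrite gk' c2 kloosterman_translationr_int ?c1//.
by rewrite kloosterman_translationl_int.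
Qed.

End Multipliers.

(** * The involution g -> -g^-1 on double cosets *)

Section DoubleCosets.
Context {R : realType}.
Variable (G : set 'M[R]_2).
Hypotheses (G_subgroup : is_subgroup G) (G_SL2 : G `<=` SL2) (G_opp1 : G (-1)).
Implicit Types (g s : 'M[R]_2) (K : R) (S : set 'M[R]_2).

Lemma stab_infty_oppV g : stab_infty G g -> stab_infty G g^-1.
Proof.
case=> gG c0; case: (G_subgroup) => _ _ /(_ _ gG)[_ VG]; split=> //.
have [_ _ + _] := SL2_oppV (G_SL2 gG).
by rewrite mxE c0 => /eqP; rewrite oppr_eq0 => /eqP.
Qed.

Lemma stab_infty_mul a b :
  stab_infty G a -> stab_infty G b -> stab_infty G (a * b).
Proof.
move=> [aG a0] [bG b0]; case: (G_subgroup) => _ GM _; split; first exact: GM.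
by rewrite mulmx2E a0 b0 mul0r mulr0 addr0.
Qed.

Lemma unitG g : G g -> g \is a GRing.unit.
Proof. by case: (G_subgroup) => _ _ GV /GV[]. Qed.

Lemma double_coset_sym s g : double_coset (stab_infty G) s g ->
  double_coset (stab_infty G) g s.
Proof.
move=> [a [b [aG bG ->]]]; exists a^-1, b^-1.
split; [exact: stab_infty_oppV..|].
have aU := unitG aG.1; have bU := unitG bG.1.
by rewrite !mulrA mulVr// mul1r mulrK.
Qed.

Lemma double_coset_trans g1 g2 g3 : double_coset (stab_infty G) g1 g2 ->
  double_coset (stab_infty G) g2 g3 -> double_coset (stab_infty G) g1 g3.
Proof.
move=> [a [b [aG bG ->]]] [c [d [cG dG ->]]]; exists (c * a), (b * d).
by split; [exact: stab_infty_mul..|rewrite !mulrA].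
Qed.

Lemma double_coset_oppV s g : G s -> double_coset (stab_infty G) s g ->
  double_coset (stab_infty G) (- s^-1) (- g^-1).
Proof.
move=> sG [a [b [aG bG ->]]]; exists b^-1, a^-1.
split; [exact: stab_infty_oppV..|].
have aU := unitG aG.1; have bU := unitG bG.1; have sU := unitG sG.
have asU : a * s \is a GRing.unit by rewrite unitrMr.
by rewrite invrM// invrM// mulrN mulNr !mulrA.
Qed.

Lemma oppV_in g : G g -> G (- g^-1).
Proof.
move=> gG; case: (G_subgroup) => _ GM /(_ _ gG)[_ VG].
by rewrite -mulN1r; exact: GM.
Qed.

Lemma oppVK g : - (- g^-1)^-1 = g.
Proof. by rewrite invrN opprK invrK. Qed.

Lemma truncation_oppV K g : truncation G K g -> truncation G K (- g^-1).
Proof.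
case=> gG cK; split; first exact: oppV_in.
by have [_ _ -> _] := SL2_oppV (G_SL2 gG).
Qed.

(** The involution permutes the double cosets, so [f] sends g to the representative in [S'] of the
    coset of [- g^-1]. *)
Lemma double_coset_reps_oppV K S S' :
  double_coset_reps G K S -> double_coset_reps G K S' ->
  exists2 f, set_bij S S' f &
    forall g, S g -> double_coset (stab_infty G) (- g^-1) (f g).
Proof.
move=> [ST _ SU] [S'T _ S'U].
pose f g := xget 0 [set s | S' s /\ double_coset (stab_infty G) s (- g^-1)].
have fP g : S g -> S' (f g) /\ double_coset (stab_infty G) (f g) (- g^-1).
  move=> Sg; have [s [sP _]] := S'U _ (truncation_oppV (ST _ Sg)).
  have ex : exists s,
      [set s | S' s /\ double_coset (stab_infty G) s (- g^-1)] s by exists s.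
  exact: xgetPex ex.
(* Applying the involution again recovers the coset of g from [f g]. *)
have fK g : S g -> double_coset (stab_infty G) (- (f g)^-1) g.
  move=> Sg; have [S'f /double_coset_oppV] := fP g Sg.
  by rewrite oppVK; apply; exact: (S'T _ S'f).1.
exists f; last by move=> g /fP[_ /double_coset_sym].
split.
- by move=> g /fP[].
- move=> g1 g2; rewrite !inE => Sg1 Sg2 f12.
  (* Injectivity: g1 and g2 both represent the coset of g1, so irredundancy of [S] identifies
     them. *)
  have [s [_ sU]] := SU _ (ST _ Sg1).
  have g11 := double_coset_trans (double_coset_sym (fK _ Sg1)) (fK _ Sg1).
  rewrite -(sU g1)//.
  apply: sU; split=> //; apply: double_coset_trans (fK _ Sg1).
  by rewrite f12; exact/double_coset_sym/fK.
(* Surjectivity: the preimage is the representative in [S] of the coset of [- s'^-1]. *)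
- move=> s' S's'; have [s [[Ss ss'] _]] := SU _ (truncation_oppV (S'T _ S's')).
  exists s => //; have [u [_ uU]] := S'U _ (S'T _ S's').
  have [S'fs fs] := fP s Ss.
  have s's : double_coset (stab_infty G) (- s^-1) s'.
    by rewrite -[s']oppVK; apply: double_coset_oppV ss'; exact: (ST _ Ss).1.
  have fs' := double_coset_trans fs s's.
  rewrite -(uU (f s))//; apply: uU; split=> //.
  exact: double_coset_trans (double_coset_sym fs') fs'.
Qed.

End DoubleCosets.

(** * Passage to the limit and the final identity *)

Lemma lim_opp_near (R : realType) (f g : R -> R[i]) :
  (\forall K \near +oo, g K = - f K) ->
  cvg (f K @[K --> +oo]) -> lim (g K @[K --> +oo]) = - lim (f K @[K --> +oo]).
Proof.
move=> gf cf.
(* Functions that agree near [+oo] have the same image filter. *)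
have -> : (g K @[K --> +oo]) = ((- f) K @[K --> +oo]).
  by apply/seteqP; split; apply: near_eq_cvg; apply: filterS gf => K /= ->.
exact: limN.
Qed.

Theorem mainTheorem1 (R : realType) (G : set 'M[R]_2) (w : R)
    (psi : 'M[R]_2 -> R[i]) (h alpha mu nu : R) (S S' : R -> set 'M[R]_2)
    (G_subgroup : is_subgroup G) (G_SL2 : G `<=` SL2) (G_opp1 : G (-1))
    (G_comm : commensurable G SL2Z)
    (psi_mult : multiplier_system G w psi)
    (psi_ext : ~ transitive_on_cusps G -> extends_to_one_cusp G psi)
    (h_width : is_width G h)
    (alpha_range : 0 <= alpha < 1) (alphaE : psi (translation h) = e1 alpha)
    (mu_lattice : shifted_lattice h alpha mu)
    (nu_lattice : shifted_lattice h alpha nu)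
    (S_reps : forall K, 0 < K -> double_coset_reps G K (S K))
    (S'_reps : forall K, 0 < K -> double_coset_reps G K (S' K))
    (c_cvg : rademacher_cvg S psi w mu nu)
    (c_conj_cvg :
      rademacher_cvg S' (conj_multiplier psi) (2 - w) (- nu) (- mu)) :
  rademacher S' h (conj_multiplier psi) (2 - w) (- nu) (- mu)
  = - rademacher S h psi w mu nu.
Proof.
have sumE K : 0 < K ->
    rademacher_sum S' (conj_multiplier psi) (2 - w) (- nu) (- mu) K =
    - rademacher_sum S psi w mu nu K.
  move=> K0; rewrite /rademacher_sum -[RHS]mulN1r mulr_fsumr.
  (* The bijection runs from [S' K] to [S K], to reindex the sum over [S K]. *)
  have [f f_bij fP] :=
    double_coset_reps_oppV G_subgroup G_SL2 G_opp1 (S'_reps K K0) (S_reps K K0).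
  rewrite [RHS](@reindex_fsbig _ _ _ _ _ f (S' K) (S K) _ f_bij).
  apply: eq_fsbigr => g; rewrite inE => S'g.
  have [S'T S'pos _] := S'_reps K K0; have [_ Spos _] := S_reps K K0.
  have gG := (S'T _ S'g).1; have c0 := S'pos _ S'g.
  have fc0 : 0 < f g 1 0 by apply/Spos/(set_bij_homo f_bij).
  have g'G : G (- g^-1) by exact: oppV_in.
  have [a' b' c' d'] := SL2_oppV (G_SL2 _ gG).
  have c'0 : 0 < (- g^-1) 1 0 by rewrite c'.
  (* The Kloosterman term at [f g] may be computed at [- g^-1], in the same double coset. *)
  have [fcE ->] := double_coset_kloosterman G_subgroup psi_mult h_width alphaE
    mu_lattice nu_lattice g'G c'0 fc0 (fP _ S'g).
  rewrite (@bessel_dual _ w mu nu (f g)); last by rewrite fcE c'.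
  have kE : kloosterman psi mu nu (- g^-1) =
      e1 (w / 2) * kloosterman (conj_multiplier psi) (- nu) (- mu) g.
    rewrite /kloosterman a' c' d' /conj_multiplier.
    rewrite -(psi_oppV G_subgroup G_SL2 psi_mult gG g'G c0).
    have -> : mu * (- g 1 1 / g 1 0) = - mu * (g 1 1 / g 1 0) by ring.
    have -> : nu * (- g 0 0 / g 1 0) = - nu * (g 0 0 / g 1 0) by ring.
    (* Inserting 1 as psi(g) times its conjugate makes the product psi(g) psi(-g^-1) appear. *)
    rewrite -[psi (- g^-1) in LHS]mul1r -(psi_normK psi_mult gG); ring.
  by rewrite kE; ring.
rewrite /rademacher -mulrN (lim_opp_near _ c_cvg)//.
by near=> K; apply: sumE; near: K; exact: nbhs_pinfty_gt.
Unshelve. all: by end_near.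
Qed.
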